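(* Let $(\mathfrak{g},[\cdot,\cdot],\alpha)$ be a multiplicative Hom-Lie superalgebra with a representation $\rho:\mathfrak{g}\to\mathfrak{gl}(V)$ satisfying $\mathrm{str}\rho\circ\alpha=\mathrm{str}\rho$, and let $(\mathfrak{g},[\cdot,\cdot,\cdot]_\rho,\alpha)$ be the induced (multiplicative) 3-ary-Hom-Lie superalgebra. Let $(\bar{\mathfrak{g}},[\cdot,\cdot]_c,\alpha_c)$ be a central extension of $(\mathfrak{g},[\cdot,\cdot],\alpha)$, where $\bar{\mathfrak{g}}=\mathfrak{g}\oplus Kc$, $[x_1,x_2]_c=[x_1,x_2]+\omega(x_1,x_2)c$ for $x_1,x_2\in\mathfrak{g}$, and $\alpha_c(\bar x)=\alpha(x)+\lambda(\bar x)c$ for $\bar x=x+x_cc\in\bar{\mathfrak{g}}$ ($x\in\mathfrak{g}$, $x_c\in K$), with $\lambda:\bar{\mathfrak{g}}\to K$ linear, and assume that $\mathrm{str}\rho$ is extended to a linear functional on $\bar{\mathfrak{g}}$ by $\mathrm{str}\rho(c)=0$. Then the 3-ary-Hom-Lie superalgebra $(\bar{\mathfrak{g}},[\cdot,\cdot,\cdot]_{c,\rho},\alpha_c)$ induced by $(\bar{\mathfrak{g}},[\cdot,\cdot]_c,\alpha_c)$ is a central extension of $(\mathfrak{g},[\cdot,\cdot,\cdot]_\rho,\alpha)$, where for homogeneous $x_1,x_2,x_3\in\mathfrak{g}$ $$[x_1,x_2,x_3]_{c,\rho}=[x_1,x_2,x_3]_\rho+\omega_\rho(x_1,x_2,x_3)c,$$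 $$\omega_\rho(x_1,x_2,x_3)=\mathrm{str}\rho(x_1)\omega(x_2,x_3)-(-1)^{|x_1||x_2|}\mathrm{str}\rho(x_2)\omega(x_1,x_3)+(-1)^{|x_3|(|x_1|+|x_2|)}\mathrm{str}\rho(x_3)\omega(x_1,x_2).$$
   Context: All vector spaces are over a field $K$; $|x|\in\mathbb{Z}_2$ is the degree of a homogeneous element; identities with signs are stated for homogeneous elements and extended linearly. A Hom-Lie superalgebra $(\mathfrak{g},[\cdot,\cdot],\alpha)$ is a $\mathbb{Z}_2$-graded vector space with an even bilinear map $[\cdot,\cdot]$ and an even linear map $\alpha:\mathfrak{g}\to\mathfrak{g}$ such that $[x,y]=-(-1)^{|x||y|}[y,x]$ and $(-1)^{|x||z|}[\alpha(x),[y,z]]+(-1)^{|y||x|}[\alpha(y),[z,x]]+(-1)^{|z||y|}[\alpha(z),[x,y]]=0$. It is multiplicative if $\alpha([x,y])=[\alpha(x),\alpha(y)]$. A representation of $(\mathfrak{g},[\cdot,\cdot],\alpha)$ on a finite-dimensional $\mathbb{Z}_2$-graded vector space $V$ with respect to an even $\beta_V\in\mathfrak{gl}(V)_{\bar0}$ is an even linear map $\rho:\mathfrak{g}\to\mathfrak{gl}(V)$ with $\rho(\alpha(x))\circ\beta_V=\beta_V\circ\rho(x)$ and $\rho([x,y])\circ\beta_V=\rho(\alpha(x))\circ\rho(y)-(-1)^{|x||y|}\rho(\alpha(y))\circ\rho(x)$. The supertrace is the linear functional with $\mathrm{str}(a)=\mathrm{Tr}(a|_{V_{\bar0}})-\mathrm{Tr}(a|_{V_{\bar1}})$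 for $a$ even and $0$ for $a$ odd; $\mathrm{str}\rho(x):=\mathrm{str}(\rho(x))$. A central extension of a Hom-Lie superalgebra $(\mathfrak{g},[\cdot,\cdot],\alpha)$ is a $\mathbb{Z}_2$-graded space $\bar{\mathfrak{g}}=\mathfrak{g}\oplus Kc$ ($c$ homogeneous) with bracket $[x_1,x_2]_c=[x_1,x_2]+\omega(x_1,x_2)c$ and $[\bar x,c]_c=0$, and map $\alpha_c(\bar x)=\alpha(x)+\lambda(\bar x)c$, where $\lambda:\bar{\mathfrak{g}}\to K$ is linear and $\omega:\mathfrak{g}\times\mathfrak{g}\to K$ is a skew-supersymmetric bilinear map, such that $(\bar{\mathfrak{g}},[\cdot,\cdot]_c,\alpha_c)$ is a Hom-Lie superalgebra (in particular $[\cdot,\cdot]_c$ and $\alpha_c$ are even and satisfy the Hom-Jacobi identity). The ternary bracket induced by a binary bracket and the functional $\mathrm{str}\rho$ is $$[x_1,x_2,x_3]_\rho=\mathrm{str}\rho(x_1)[x_2,x_3]-(-1)^{|x_1||x_2|}\mathrm{str}\rho(x_2)[x_1,x_3]+(-1)^{|x_3|(|x_1|+|x_2|)}\mathrm{str}\rho(x_3)[x_1,x_2];$$ $[\cdot,\cdot,\cdot]_{c,\rho}$ is given by the same formula on $\bar{\mathfrak{g}}$ with $[\cdot,\cdot]_c$ and the extended $\mathrm{str}\rho$. A 3-ary-Hom-Lie superalgebra $(\mathfrak{g},[\cdot,\cdot,\cdot],\alpha)$ is a $\mathbb{Z}_2$-graded vector space with an even trilinear bracket and an even linear map $\alpha$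 such that $[x_1,x_2,x_3]=-(-1)^{|x_1||x_2|}[x_2,x_1,x_3]=-(-1)^{|x_2||x_3|}[x_1,x_3,x_2]$ and $$[\alpha(x),\alpha(y),[z,u,v]]=[[x,y,z],\alpha(u),\alpha(v)]+(-1)^{|z|(|x|+|y|)}[\alpha(z),[x,y,u],\alpha(v)]+(-1)^{(|z|+|u|)(|x|+|y|)}[\alpha(z),\alpha(u),[x,y,v]].$$ A central extension of it is a 3-ary-Hom-Lie superalgebra on $\mathfrak{g}\oplus Kc$ whose bracket is $[x_1,x_2,x_3]+\omega'(x_1,x_2,x_3)c$ on $\mathfrak{g}$ for a skew-supersymmetric trilinear form $\omega':\mathfrak{g}^3\to K$ and vanishes whenever one argument is $c$, with structure map of the form $\bar x\mapsto\alpha(x)+\lambda(\bar x)c$, $\lambda$ linear.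
   Formalization: The formal theorem adds the hypothesis that str ρ([x,y]) = 0 for all x, y in g; without it the induced bracket on the central extension can violate the Hom-Nambu identity (e.g. Heisenberg ⊕ K with α = id, β_V = 0). *)

(* Defs.v *)
From HB Require Import structures.
From mathcomp Require Import all_boot all_order all_algebra.

Set Implicit Arguments.
Unset Strict Implicit.
Unset Printing Implicit Defensive.

Import GRing.Theory.
Local Open Scope ring_scope.

(* Degrees in Z_2 are booleans ([false] is even, [true] is odd): [i (+) j] is
   the sum of two degrees, [i && j] their product, and (-1)^{|x||y|} is
   [(-1) ^+ (i && j)] when x, y have degrees i, j.

   A Z_2-grading is given by its two component maps x |-> x_i, a complete pair
   of orthogonal idempotents; [homog_decomposition] recovers the direct sum.
   The zero vector is homogeneous of both degrees. *)
Record grading (K : fieldType) (g : lmodType K) := Grading {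
  hcomp :> bool -> {linear g -> g};
  hcomp_idem : forall i j x, hcomp i (hcomp j x) = if i == j then hcomp j x else 0;
  hcomp_sum : forall x, hcomp false x + hcomp true x = x }.

Definition homog (K : fieldType) (g : lmodType K) (G : grading g)
  (i : bool) (x : g) : Prop := G i x = x.

Lemma homog_decomposition (K : fieldType) (g : lmodType K) (G : grading g) x :
  exists! p : g * g,
    [/\ homog G false p.1, homog G true p.2 & x = p.1 + p.2].
Proof.
exists (G false x, G true x); split.
  by split; rewrite /homog /= ?hcomp_idem ?hcomp_sum.
move=> [y z] [/= hy hz ->]; rewrite !linearD /= -hy -hz !hcomp_idem /=.
by rewrite addr0 add0r hy hz.
Qed.

Definition even_map (K : fieldType) (g h : lmodType K) (G : grading g)
  (H : grading h) (f : g -> h) : Prop :=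
  forall i x, homog G i x -> homog H i (f x).

Definition skew2 (K : fieldType) (g W : lmodType K) (G : grading g)
  (f : g -> g -> W) : Prop :=
  forall i j x y, homog G i x -> homog G j y ->
    f x y = - ((-1) ^+ (i && j) *: f y x).

Definition skew3 (K : fieldType) (g W : lmodType K) (G : grading g)
  (f : g -> g -> g -> W) : Prop :=
  forall i j k x y z, homog G i x -> homog G j y -> homog G k z ->
    f x y z = - ((-1) ^+ (i && j) *: f y x z) /\
    f x y z = - ((-1) ^+ (j && k) *: f x z y).

Definition bilinear_map (K : fieldType) (g W : lmodType K)
  (f : g -> g -> W) : Prop :=
  (forall x, linear (f x)) /\ (forall y, linear (fun x => f x y)).

Definition trilinear_map (K : fieldType) (g W : lmodType K)
  (f : g -> g -> g -> W) : Prop :=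
  [/\ forall y z, linear (fun x => f x y z),
      forall x z, linear (fun y => f x y z)
    & forall x y, linear (fun z => f x y z)].

Record hom_lie_superalgebra (K : fieldType) (g : lmodType K) (G : grading g)
    (br : g -> g -> g) (alpha : g -> g) : Prop := HomLieSuperalgebra {
  hl_bilinear : bilinear_map br;
  hl_even : forall i j x y, homog G i x -> homog G j y ->
    homog G (i (+) j) (br x y);
  hl_alpha_linear : linear alpha;
  hl_alpha_even : even_map G G alpha;
  hl_skew : skew2 G br;
  hl_jacobi : forall i j k x y z, homog G i x -> homog G j y -> homog G k z ->
      (-1) ^+ (i && k) *: br (alpha x) (br y z)
    + (-1) ^+ (j && i) *: br (alpha y) (br z x)
    + (-1) ^+ (k && j) *: br (alpha z) (br x y) = 0 }.

Definition multiplicative2 (K : fieldType) (g : lmodType K)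
  (br : g -> g -> g) (alpha : g -> g) : Prop :=
  forall x y, alpha (br x y) = br (alpha x) (alpha y).

Record hom_lie3_superalgebra (K : fieldType) (g : lmodType K) (G : grading g)
    (br : g -> g -> g -> g) (alpha : g -> g) : Prop := HomLie3Superalgebra {
  hl3_trilinear : trilinear_map br;
  hl3_even : forall i j k x y z, homog G i x -> homog G j y -> homog G k z ->
    homog G (i (+) j (+) k) (br x y z);
  hl3_alpha_linear : linear alpha;
  hl3_alpha_even : even_map G G alpha;
  hl3_skew : skew3 G br;
  hl3_nambu : forall i j k l m x y z u v,
    homog G i x -> homog G j y -> homog G k z -> homog G l u -> homog G m v ->
    br (alpha x) (alpha y) (br z u v) =
        br (br x y z) (alpha u) (alpha v)
      + (-1) ^+ (k && (i (+) j)) *: br (alpha z) (br x y u) (alpha v)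
      + (-1) ^+ ((k (+) l) && (i (+) j)) *: br (alpha z) (alpha u) (br x y v) }.

Definition multiplicative3 (K : fieldType) (g : lmodType K)
  (br : g -> g -> g -> g) (alpha : g -> g) : Prop :=
  forall x y z, alpha (br x y z) = br (alpha x) (alpha y) (alpha z).

Section Supertrace.
Variables (K : fieldType) (V : vectType K) (GV : grading V).

Definition End_homog (i : bool) (a : 'End(V)) : Prop :=
  forall j v, homog GV j v -> homog GV (i (+) j) (a v).

Definition part (i : bool) : {vspace V} := limg (linfun (GV i)).

Lemma partP i v : reflect (homog GV i v) (v \in part i).
Proof.
apply: (iffP memv_imgP) => [[u _ ->]|<-].
  by rewrite lfunE /homog hcomp_idem eqxx.
by exists v; rewrite ?memvf ?lfunE.
Qed.

(* The trace of the restriction of a to a subspace U stable under a. *)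
Definition trace_on (U : {vspace V}) (a : 'End(V)) : K :=
  \sum_(i < \dim U) coord (vbasis U) i (a (vbasis U)`_i).

Definition even_part (a : 'End(V)) : 'End(V) :=
  \sum_i (linfun (GV i) \o a \o linfun (GV i))%VF.

Definition str (a : 'End(V)) : K :=
  trace_on (part false) (even_part a) - trace_on (part true) (even_part a).

Lemma even_partE a v :
  even_part a v = GV false (a (GV false v)) + GV true (a (GV true v)).
Proof.
by rewrite /even_part big_bool /= add_lfunE !comp_lfunE !lfunE /= addrC.
Qed.

Lemma str_even a : End_homog false a ->
  str a = trace_on (part false) a - trace_on (part true) a.
Proof.
move=> ha; suff e : even_part a = a by rewrite /str e.
apply/lfunP => v; rewrite even_partE.
have hG i : homog GV i (GV i v) by rewrite /homog hcomp_idem eqxx.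
rewrite (ha _ _ (hG false)) (ha _ _ (hG true)) -linearD.
by rewrite hcomp_sum.
Qed.

Lemma str_odd a : End_homog true a -> str a = 0.
Proof.
move=> ha; suff e0 : even_part a = 0.
  by rewrite /str /trace_on e0 !big1 ?subrr // => i _; rewrite lfunE linear0.
apply/lfunP => v; rewrite even_partE lfunE /=.
have hG i : homog GV i (GV i v) by rewrite /homog hcomp_idem eqxx.
by rewrite -(ha _ _ (hG false)) -(ha _ _ (hG true)) !hcomp_idem addr0.
Qed.

End Supertrace.

Record representation (K : fieldType) (g : lmodType K) (G : grading g)
    (br : g -> g -> g) (alpha : g -> g)
    (V : vectType K) (GV : grading V) (beta : 'End(V)) (rho : g -> 'End(V)) :
    Prop := Representation {
  rep_beta_even : End_homog GV false beta;
  rep_linear : linear rho;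
  rep_even : forall i x, homog G i x -> End_homog GV i (rho x);
  rep_alpha : forall x, (rho (alpha x) \o beta = beta \o rho x)%VF;
  rep_bracket : forall i j x y, homog G i x -> homog G j y ->
    (rho (br x y) \o beta)%VF =
      (rho (alpha x) \o rho y)%VF
      - (-1) ^+ (i && j) *: (rho (alpha y) \o rho x)%VF }.

(* i, j, k are the degrees of x, y, z; [ternary] is the trilinear extension to
   arguments that need not be homogeneous.  With values in any module W, the
   same formula yields the ternary bracket (f the binary bracket) and the form
   omega_rho (f = omega). *)
Definition ternary_homog (K : fieldType) (g W : lmodType K) (tau : g -> K)
  (f : g -> g -> W) (i j k : bool) (x y z : g) : W :=
  tau x *: f y z
  - (-1) ^+ (i && j) *: (tau y *: f x z)
  + (-1) ^+ (k && (i (+) j)) *: (tau z *: f x y).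

Definition ternary (K : fieldType) (g W : lmodType K) (G : grading g)
  (tau : g -> K) (f : g -> g -> W) (x y z : g) : W :=
  \sum_i \sum_j \sum_k ternary_homog tau f i j k (G i x) (G j y) (G k z).

Lemma ternaryE (K : fieldType) (g W : lmodType K) (G : grading g)
    (tau : g -> K) (f : g -> g -> W) i j k x y z :
  scalar tau -> bilinear_map f ->
  homog G i x -> homog G j y -> homog G k z ->
  ternary G tau f x y z = ternary_homog tau f i j k x y z.
Proof.
move=> ltau [lf rf] hx hy hz.
have tau0 : tau 0 = 0.
  by have := ltau (-1) 0 0; rewrite scaler0 addr0 mulN1r addNr.
have f0r u : f u 0 = 0.
  by have := lf u (-1) 0 0; rewrite scaler0 addr0 scaleN1r addNr.
have f0l u : f 0 u = 0.
  by have := rf u (-1) 0 0; rewrite scaler0 addr0 scaleN1r addNr.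
have hE a t b : homog G a t -> G b t = if b == a then t else 0.
  by move=> <-; rewrite hcomp_idem.
rewrite /ternary (bigD1 i) //= [X in _ + X]big1 ?addr0; last first.
  move=> a /negPf na; rewrite big1 // => b _; rewrite big1 // => c _.
  rewrite (hE _ _ a hx) na /ternary_homog tau0 !f0l.
  by rewrite !(scale0r, scaler0, oppr0, addr0).
rewrite (bigD1 j) //= [X in _ + X]big1 ?addr0; last first.
  move=> b /negPf nb; rewrite big1 // => c _.
  rewrite (hE _ _ b hy) nb /ternary_homog tau0 f0l f0r.
  by rewrite !(scale0r, scaler0, oppr0, addr0).
rewrite (bigD1 k) //= [X in _ + X]big1 ?addr0; last first.
  move=> c /negPf nc; rewrite (hE _ _ c hz) nc /ternary_homog tau0 !f0r.
  by rewrite !(scale0r, scaler0, oppr0, addr0).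
by rewrite hx hy hz.
Qed.

(* The space g + Kc is [g * K^o], with x + a c encoded as [(x, a)] and c placed
   in degree d. *)
Section Extension.
Variables (K : fieldType) (g : lmodType K) (G : grading g) (d : bool).

Definition ext_hcomp (i : bool) (u : g * K^o) : g * K^o :=
  (G i u.1, if i == d then u.2 else 0).

Lemma ext_hcomp_linear i : linear (ext_hcomp i).
Proof.
move=> a u v; rewrite /ext_hcomp linearP /=.
by case: eqP => // _; apply: (congr1 (pair _)); rewrite /= scaler0 addr0.
Qed.

HB.instance Definition _ i :=
  GRing.isLinear.Build K (g * K^o)%type (g * K^o)%type *:%R (ext_hcomp i)
    (ext_hcomp_linear i).

Lemma ext_hcomp_idem i j u :
  ext_hcomp i (ext_hcomp j u) = if i == j then ext_hcomp j u else 0.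
Proof.
rewrite /ext_hcomp /= hcomp_idem; case: (eqVneq i j) => [->|].
  by case: eqP.
by case: i j d => [] [] [].
Qed.

Lemma ext_hcomp_sum u : ext_hcomp false u + ext_hcomp true u = u.
Proof.
case: u => x a; rewrite /ext_hcomp; apply/pair_equal_spec.
by split; rewrite /= ?hcomp_sum //; case: d => /=; rewrite ?addr0 ?add0r.
Qed.

Definition ext_grading : grading (g * K^o)%type :=
  Grading ext_hcomp_idem ext_hcomp_sum.

End Extension.

Definition central_elt (K : fieldType) (g : lmodType K) : (g * K^o)%type := (0, 1).

Record central_extension2 (K : fieldType) (g : lmodType K) (G : grading g)
    (br : g -> g -> g) (alpha : g -> g) (d : bool)
    (brc : g * K^o -> g * K^o -> g * K^o) (alphac : g * K^o -> g * K^o)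
    (omega : g -> g -> K^o) (lambda : g * K^o -> K^o) : Prop :=
  CentralExtension2 {
  ce2_base : hom_lie_superalgebra G br alpha;
  ce2_total : hom_lie_superalgebra (ext_grading G d) brc alphac;
  ce2_omega_bilinear : bilinear_map omega;
  ce2_omega_skew : skew2 G omega;
  ce2_lambda_linear : linear lambda;
  ce2_bracket : forall x y, brc (x, 0) (y, 0) = (br x y, omega x y);
  ce2_central : forall u, brc u (central_elt g) = 0;
  ce2_alpha : forall u, alphac u = (alpha u.1, lambda u) }.

Record central_extension3 (K : fieldType) (g : lmodType K) (G : grading g)
    (br : g -> g -> g -> g) (alpha : g -> g) (d : bool)
    (brc : g * K^o -> g * K^o -> g * K^o -> g * K^o)
    (alphac : g * K^o -> g * K^o)
    (omega : g -> g -> g -> K^o) (lambda : g * K^o -> K^o) : Prop :=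
  CentralExtension3 {
  ce3_base : hom_lie3_superalgebra G br alpha;
  ce3_total : hom_lie3_superalgebra (ext_grading G d) brc alphac;
  ce3_omega_trilinear : trilinear_map omega;
  ce3_omega_skew : skew3 G omega;
  ce3_lambda_linear : linear lambda;
  ce3_bracket : forall x y z,
    brc (x, 0) (y, 0) (z, 0) = (br x y z, omega x y z);
  ce3_central : forall u v,
    [/\ brc (central_elt g) u v = 0, brc u (central_elt g) v = 0
      & brc u v (central_elt g) = 0];
  ce3_alpha : forall u, alphac u = (alpha u.1, lambda u) }.

(* Main.v *)
(** Since [str rho] vanishes on odd elements, every sign in the ternary bracket
    is multiplied by zero unless it is 1, so that the bracket is
    [x, y, z] = tau x [y, z] - tau y [x, z] + tau z [x, y] for arbitrary x, y, z,
    with tau = [str rho].  As tau kills brackets, [x, y, p] = D p + tau p [x, y]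
    where D p = tau x [y, p] - tau y [x, p]; the Hom-Jacobi identity makes D a
    twisted derivation, and the Nambu identity follows, the terms in [x, y]
    cancelling in pairs.  This applies to g and to g + Kc alike: the extended tau
    is still invariant under alpha_c and still kills odd elements and brackets. *)
Require Import Defs.
From HB Require Import structures.
From mathcomp Require Import all_boot all_order all_algebra.
Import GRing.Theory.
Local Open Scope ring_scope.

Set Implicit Arguments.
Unset Strict Implicit.

(** * Consequences of linearity as a predicate on plain functions *)

Section LinearFunctions.
Variables (K : fieldType) (U W : lmodType K).

Lemma linear_fun0 (f : U -> W) : linear f -> f 0 = 0.
Proof.
by move=> lf; have := lf (-1) 0 0; rewrite scaler0 addr0 scaleN1r addNr.
Qed.

Lemma linear_funD (f : U -> W) : linear f -> {morph f : x y / x + y}.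
Proof. by move=> lf x y; have := lf 1 x y; rewrite !scale1r. Qed.

Lemma linear_funZ (f : U -> W) a x : linear f -> f (a *: x) = a *: f x.
Proof. by move=> lf; have := lf a x 0; rewrite !addr0 linear_fun0 // addr0. Qed.

Lemma linear_funN (f : U -> W) x : linear f -> f (- x) = - f x.
Proof. by move=> lf; rewrite -!scaleN1r linear_funZ. Qed.

Lemma linear_fun_add (f1 f2 : U -> W) :
  linear f1 -> linear f2 -> linear (fun x => f1 x + f2 x).
Proof. by move=> l1 l2 k x y; rewrite l1 l2 scalerDr addrACA. Qed.

Lemma linear_fun_sub (f1 f2 : U -> W) :
  linear f1 -> linear f2 -> linear (fun x => f1 x - f2 x).
Proof. by move=> l1 l2 k x y; rewrite l1 l2 scalerBr opprD addrACA. Qed.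

Lemma linear_fun_scale a (f : U -> W) : linear f -> linear (fun x => a *: f x).
Proof. by move=> lf k x y; rewrite lf scalerDr !scalerA mulrC. Qed.

Lemma linear_scale_fun (t : U -> K) (w : W) :
  scalar t -> linear (fun x => t x *: w).
Proof. by move=> lt k x y; rewrite lt scalerDl scalerA. Qed.

End LinearFunctions.

(** * The sign-free form of the ternary bracket *)

Section UnsignedTernary.
Variables (K : fieldType) (g : lmodType K) (G : grading g) (tau : g -> K).
Hypotheses (tau_lin : scalar tau) (tau_odd : forall x, tau (G true x) = 0).

Lemma scalar_eq0_of_odd x : homog G true x -> tau x = 0.
Proof. by move=> <-; exact: tau_odd. Qed.

Definition ternary_pure (W : lmodType K) (f : g -> g -> W) x y z : W :=
  tau x *: f y z - tau y *: f x z + tau z *: f x y.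

Lemma ternary_pure_trilinear (W : lmodType K) (f : g -> g -> W) :
  bilinear_map f -> trilinear_map (ternary_pure f).
Proof.
move=> [lf rf]; split=> *; (apply: linear_fun_add; first apply: linear_fun_sub);
  by [apply: linear_scale_fun | apply: linear_fun_scale].
Qed.

(** The sign $(-1)^{ij}$ stands next to [tau y], which vanishes for odd [j]; the sign
    $(-1)^{k(i+j)}$ stands next to [tau z], which vanishes for odd [k]. *)
Lemma ternary_homog_pure (W : lmodType K) (f : g -> g -> W) i j k x y z :
  homog G i x -> homog G j y -> homog G k z ->
  ternary_homog tau f i j k x y z = ternary_pure f x y z.
Proof.
move=> hx hy hz; rewrite /ternary_homog /ternary_pure.
case: j hy => [/scalar_eq0_of_odd->|_]; rewrite ?andbF ?expr0 ?scale1r;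
case: k hz => [/scalar_eq0_of_odd->|_];
  by rewrite /= ?expr0 ?scale1r ?scale0r ?scaler0.
Qed.

(** The sign-free expression is trilinear, so summing it over the homogeneous components of each
    argument in turn gives back its value at [x], [y], [z]. *)
Lemma ternary_pureE (W : lmodType K) (f : g -> g -> W) x y z :
  bilinear_map f -> ternary G tau f x y z = ternary_pure f x y z.
Proof.
move=> bf; have [l1 l2 l3] := ternary_pure_trilinear bf.
have hG i t : homog G i (G i t) by rewrite /homog hcomp_idem eqxx.
have sumG (h : g -> W) t : linear h -> \sum_i h (G i t) = h t.
  by move=> lh; rewrite big_bool /= -(linear_funD lh) addrC hcomp_sum.
rewrite -(sumG _ _ (l1 y z)); apply: eq_bigr => i _.
rewrite -(sumG _ _ (l2 (G i x) z)); apply: eq_bigr => j _.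
rewrite -(sumG _ _ (l3 (G i x) (G j y))); apply: eq_bigr => k _.
exact: ternary_homog_pure.
Qed.

End UnsignedTernary.

(** The additive skeleton of the Nambu identity: [a], [b], [c] stand for the terms in [D] with
    coefficients [tau z], [tau u], [tau v], and [e1], [e2], [e3] for the terms in [x, y]. *)
Lemma nambu_cancellation (W : zmodType) (a1 a2 b1 b2 c1 c2 e1 e2 e3 : W) :
  a1 + a2 - (b1 + b2) + (c1 + c2) =
  - (b1 + e1) + (c1 + e2) + (a1 + e1 + (c2 - e3)) + (a2 - e2 - (b2 - e3)).
Proof.
rewrite !opprD !opprK.
(* The last three pairs are [e1], [e2], [e3], each with its opposite. *)
rewrite [RHS](AC (2*2*(2*2)*(2*2))
  ((5*9)*(1*11)*(3*7)*(6*2)*(4*10)*(12*8))%AC) /=.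
by rewrite !subrr !addr0.
Qed.

Lemma homog_add (K : fieldType) (g : lmodType K) (G : grading g) i x y :
  homog G i x -> homog G i y -> homog G i (x + y).
Proof. by rewrite /homog linearD => -> ->. Qed.

Lemma homog_scale (K : fieldType) (g : lmodType K) (G : grading g) i a x :
  homog G i x -> homog G i (a *: x).
Proof. by rewrite /homog linearZ => ->. Qed.

(** * Skewness, parity and Nambu identity of the induced bracket *)

Section InducedTernary.
Variables (K : fieldType) (g : lmodType K) (G : grading g) (tau : g -> K).
Hypotheses (tau_lin : scalar tau) (tau_odd : forall x, tau (G true x) = 0).

Lemma scale_sign_even i b x (W : lmodType K) (w : W) : homog G i x ->
  (-1) ^+ (i && b) *: (tau x *: w) = tau x *: w.
Proof.
by case: i => [/(scalar_eq0_of_odd tau_odd)->|_];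
  rewrite ?scale0r ?scaler0 ?scale1r.
Qed.

Lemma scale_sign_evenr i b x (W : lmodType K) (w : W) : homog G i x ->
  (-1) ^+ (b && i) *: (tau x *: w) = tau x *: w.
Proof. by rewrite andbC; exact: scale_sign_even. Qed.

Lemma ternary_trilinear (W : lmodType K) (f : g -> g -> W) :
  bilinear_map f -> trilinear_map (ternary G tau f).
Proof.
move=> bf; have [l1 l2 l3] := ternary_pure_trilinear tau_lin bf.
by split=> a b k u v; rewrite !ternary_pureE // (l1, l2, l3).
Qed.

(** A transposition of neighbours exchanges two of the three terms, whose signs [tau] absorbs; in
    the third it swaps the arguments of [f]. *)
Lemma ternary_skew (W : lmodType K) (f : g -> g -> W) :
  bilinear_map f -> skew2 G f -> skew3 G (ternary G tau f).
Proof.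
move=> bf sf i j k x y z hx hy hz.
rewrite !ternary_pureE // /ternary_pure !scalerDr !scalerN; split.
  rewrite (scale_sign_even _ _ hx) (scale_sign_evenr _ _ hy) (sf _ _ _ _ hx hy).
  by rewrite scalerN scalerA mulrC -scalerA !opprD opprK [- _ + _]addrC.
rewrite (scale_sign_even _ _ hy) (scale_sign_evenr _ _ hz) (sf _ _ _ _ hy hz).
by rewrite scalerN scalerA mulrC -scalerA !opprD opprK addrAC.
Qed.

Variables (br : g -> g -> g) (alpha : g -> g).
Hypothesis hg : hom_lie_superalgebra G br alpha.

(** This is the Hom-Jacobi identity solved for its first term, after [z, x] and [alpha z, [x, y]]
    are turned round by skew-supersymmetry. *)
Lemma hom_leibniz i j k x y z : homog G i x -> homog G j y -> homog G k z ->
  br (alpha x) (br y z) =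
    br (br x y) (alpha z) + (-1) ^+ (i && j) *: br (alpha y) (br x z).
Proof.
move=> hx hy hz; have := hl_jacobi hg hx hy hz.
have ha := hl_alpha_even hg; have he := hl_even hg; have sk := hl_skew hg.
have [lf _] := hl_bilinear hg.
rewrite (sk _ _ _ _ hz hx) (sk _ _ _ _ (ha _ _ hz) (he _ _ _ _ hx hy)).
rewrite (linear_funN _ (lf _)) (linear_funZ _ _ (lf _)).
set A := br _ _; set B := br _ _; set C := br _ _.
move=> E; apply/eqP; rewrite -subr_eq0; apply/eqP.
(* Up to the invertible factor $(-1)^{ik}$ the difference is the Hom-Jacobi sum; the signs are
   compared in all eight cases of the degrees. *)
have: (-1) ^+ (i && k) *: (A - (C + (-1) ^+ (i && j) *: B)) = 0.
  rewrite -[RHS]E opprD [- C - _]addrC addrA !scalerDr !scalerN !scalerA.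
  by rewrite -!signr_addb; case: i j k {hx hy hz E} => [] [] [].
by move/eqP; rewrite scaler_eq0 signr_eq0 => /eqP.
Qed.

Hypotheses (tau_alpha : forall x, tau (alpha x) = tau x)
  (tau_br : forall x y, tau (br x y) = 0).

Lemma ternary_multiplicative :
  multiplicative2 br alpha -> multiplicative3 (ternary G tau br) alpha.
Proof.
move=> mu x y z; have bf := hl_bilinear hg; have la := hl_alpha_linear hg.
rewrite !ternary_pureE // /ternary_pure !(linear_funD la) (linear_funN _ la).
by rewrite !(linear_funZ _ _ la) !mu !tau_alpha.
Qed.

(** A term survives only if the argument of [tau] is even, and then the bracket of the other two
    already has the total degree. *)
Lemma ternary_even i j k x y z : homog G i x -> homog G j y -> homog G k z ->
  homog G (i (+) j (+) k) (ternary G tau br x y z).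
Proof.
move=> hx hy hz; have bf := hl_bilinear hg; rewrite ternary_pureE //.
have zero l : homog G l 0 by rewrite /homog linear0.
have he := hl_even hg.
rewrite /ternary_pure -scaleNr; do ![apply: homog_add].
- case: i hx => [/(scalar_eq0_of_odd tau_odd)->|_]; first by rewrite scale0r.
  by apply: homog_scale; apply: he.
- case: j hy => [/(scalar_eq0_of_odd tau_odd)->|_];
  first by rewrite oppr0 scale0r.
  by rewrite addbF; apply: homog_scale; apply: he.
- case: k hz => [/(scalar_eq0_of_odd tau_odd)->|_]; first by rewrite scale0r.
  by rewrite addbF; apply: homog_scale; apply: he.
Qed.

(* With tau x <> 0 only for even x, the sign (-1)^(jk) of [hom_leibniz] is that of
   the degree i + j of D = tau x [y, .] - tau y [x, .]. *)
Lemma nambu_derivation i j k l x y u v :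
  homog G i x -> homog G j y -> homog G k u -> homog G l v ->
  tau x *: br (alpha y) (br u v) - tau y *: br (alpha x) (br u v) =
    br (tau x *: br y u - tau y *: br x u) (alpha v)
    + (-1) ^+ (k && (i (+) j)) *:
        br (alpha u) (tau x *: br y v - tau y *: br x v).
Proof.
move=> hx hy hu hv; have [lf rf] := hl_bilinear hg.
rewrite (hom_leibniz hy hu hv) (hom_leibniz hx hu hv).
rewrite (linear_funD (rf _)) (linear_funD (lf _)).
rewrite (linear_funN _ (rf _)) (linear_funN _ (lf _)).
rewrite !(linear_funZ _ _ (rf _)) !(linear_funZ _ _ (lf _)).
rewrite !scalerDr opprD addrACA scalerN ![_ *: (_ ^+ _ *: _)]scalerA.
congr (_ + (_ - _)).
  case: i hx => [/(scalar_eq0_of_odd tau_odd)->|_];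
    first by rewrite !mul0r !scale0r scaler0.
  by rewrite addFb andbC mulrC -scalerA.
case: j hy => [/(scalar_eq0_of_odd tau_odd)->|_];
  first by rewrite !mul0r !scale0r scaler0.
by rewrite addbF andbC mulrC -scalerA.
Qed.

Lemma ternary_nambu i j k l m x y z u v (p := ternary G tau br) :
  homog G i x -> homog G j y -> homog G k z -> homog G l u -> homog G m v ->
  p (alpha x) (alpha y) (p z u v) =
      p (p x y z) (alpha u) (alpha v)
    + (-1) ^+ (k && (i (+) j)) *: p (alpha z) (p x y u) (alpha v)
    + (-1) ^+ ((k (+) l) && (i (+) j)) *: p (alpha z) (alpha u) (p x y v).
Proof.
rewrite {}/p => hx hy hz hu hv; have bf := hl_bilinear hg; have [lf rf] := bf.
have tau_lin' : linear (tau : g -> K^o) by exact: tau_lin.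
have tau0 a b c : tau (ternary_pure tau br a b c) = 0.
  rewrite /ternary_pure !(linear_funD tau_lin') (linear_funN _ tau_lin').
  by rewrite !(linear_funZ _ _ tau_lin') !tau_br !scaler0 subr0 addr0.
pose D q := tau x *: br y q - tau y *: br x q.
have pD q : ternary_pure tau br x y q = D q + tau q *: br x y by [].
have hw := hl_even hg hx hy; have ha := hl_alpha_even hg.
(* Skew-supersymmetry of [alpha q, [x, y]] produces the same sign $(-1)^{n(i+j)}$, so the two signs
   cancel and only the minus remains. *)
have signw n c q : homog G n q ->
    (-1) ^+ (n && (i (+) j)) *: (c *: br (alpha q) (br x y)) =
    - (c *: br (br x y) (alpha q)).
  move=> hq; rewrite (hl_skew hg (ha _ _ hq) hw) scalerN scalerN; congr (- _).
  by rewrite !scalerA mulrAC -signr_addb addbb mul1r.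
rewrite !ternary_pureE //.
(* Since [tau] kills the inner bracket, the left side is tau x [alpha y, .] - tau y [alpha x, .]
   applied to it; [nambu_derivation] expands each of the three terms. *)
have -> : ternary_pure tau br (alpha x) (alpha y) (ternary_pure tau br z u v) =
    tau z *: (br (D u) (alpha v)
              + (-1) ^+ (l && (i (+) j)) *: br (alpha u) (D v))
    - tau u *: (br (D z) (alpha v)
              + (-1) ^+ (k && (i (+) j)) *: br (alpha z) (D v))
    + tau v *: (br (D z) (alpha u)
              + (-1) ^+ (k && (i (+) j)) *: br (alpha z) (D u)).
  rewrite -(nambu_derivation hx hy hu hv) -(nambu_derivation hx hy hz hv).
  rewrite -(nambu_derivation hx hy hz hu).
  rewrite {1}/ternary_pure tau0 scale0r addr0 !tau_alpha.
  have lD : linear (fun q => tau x *: br (alpha y) q - tau y *: br (alpha x) q).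
    by apply: linear_fun_sub; apply: linear_fun_scale.
  rewrite /(ternary_pure _ _ z u v) (linear_funD lD) (linear_funD lD).
  by rewrite (linear_funN _ lD) !(linear_funZ _ _ lD).
have tD q : tau (D q + tau q *: br x y) = 0 by rewrite -pD tau0.
have Dl q c r : br (D q + c *: br x y) r = br (D q) r + c *: br (br x y) r.
  by rewrite (linear_funD (rf _)) (linear_funZ _ _ (rf _)).
have Dr q c r : br r (D q + c *: br x y) = br r (D q) + c *: br r (br x y).
  by rewrite (linear_funD (lf _)) (linear_funZ _ _ (lf _)).
(* Next to [tau z] the degree [k] counts as even, and next to [tau u] so does [l]; this reduces the
   sign of the third Nambu term to those of the expanded left side. *)
have sz (w : g) : (-1) ^+ ((k (+) l) && (i (+) j)) *: (tau z *: w)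
    = tau z *: ((-1) ^+ (l && (i (+) j)) *: w).
  case: (k) hz => [/(scalar_eq0_of_odd tau_odd)->|_];
    first by rewrite !scale0r scaler0.
  by rewrite !scalerA mulrC.
have su (w : g) : (-1) ^+ ((k (+) l) && (i (+) j)) *: (tau u *: w)
    = tau u *: ((-1) ^+ (k && (i (+) j)) *: w).
  case: (l) hu => [/(scalar_eq0_of_odd tau_odd)->|_];
    first by rewrite !scale0r scaler0.
  by rewrite addbF !scalerA mulrC.
have sv (w : g) : (-1) ^+ (k && (i (+) j)) *: (tau v *: w)
    = tau v *: ((-1) ^+ (k && (i (+) j)) *: w) by rewrite !scalerA mulrC.
rewrite !pD /ternary_pure !tD !tau_alpha !scale0r sub0r subr0 addr0.
rewrite !Dl !Dr !scalerDr !scalerN !scalerDr !sz !su !(scale_sign_even _ _ hz) !sv.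
(* In one term with [alpha z, [x, y]] the sign has been carried past [tau v]; it is moved back
   outside so that [signw] applies. *)
rewrite -(sv (br _ (br x y))) (signw _ _ _ hu) !(signw _ _ _ hz) !scalerN.
rewrite !scalerA [tau v * tau z]mulrC [tau u * tau z]mulrC [tau v * tau u]mulrC.
exact: nambu_cancellation.
Qed.

End InducedTernary.

Lemma ternary_hom_lie3 (K : fieldType) (g : lmodType K) (G : grading g)
    (tau : g -> K) (br : g -> g -> g) (alpha : g -> g) :
  scalar tau -> (forall x, tau (G true x) = 0) ->
  hom_lie_superalgebra G br alpha ->
  (forall x, tau (alpha x) = tau x) -> (forall x y, tau (br x y) = 0) ->
  hom_lie3_superalgebra G (ternary G tau br) alpha.
Proof.
move=> lt t1 hg ta tb; split.
- exact: (ternary_trilinear lt t1 (hl_bilinear hg)).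
- by move=> *; apply: (ternary_even lt t1 hg).
- exact: hl_alpha_linear hg.
- exact: hl_alpha_even hg.
- exact: (ternary_skew lt t1 (hl_bilinear hg) (hl_skew hg)).
- by move=> *; apply: (ternary_nambu lt t1 hg ta tb); eassumption.
Qed.

(** * The bracket of a central extension in coordinates *)

Section CentralElement.
Variables (K : fieldType) (g : lmodType K).

Lemma pair_central (x : g) (a : K^o) : (x, a) = a *: central_elt g + (x, 0).
Proof.
by apply/pair_equal_spec; rewrite /= scaler0 add0r addr0 /GRing.scale /= mulr1.
Qed.

Variables (G : grading g) (br : g -> g -> g) (alpha : g -> g) (d : bool).
Variables (brc : g * K^o -> g * K^o -> g * K^o) (alphac : g * K^o -> g * K^o).
Variables (omega : g -> g -> K^o) (lambda : g * K^o -> K^o).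
Hypothesis hext : central_extension2 G br alpha d brc alphac omega lambda.

(** Centrality is given with c on the right only. As c is homogeneous of degree [d],
    skew-supersymmetry moves it to the left for each homogeneous component of [u]. *)
Lemma central_bracketl u : brc (central_elt g) u = 0.
Proof.
have ht := ce2_total hext; have [lf rf] := hl_bilinear ht.
have hc : homog (ext_grading G d) d (central_elt g).
  by rewrite /homog /= /ext_hcomp /= linear0 eqxx.
have hG i : homog (ext_grading G d) i (ext_grading G d i u).
  by rewrite /homog hcomp_idem eqxx.
have c0 i : brc (central_elt g) (ext_grading G d i u) = 0.
  by rewrite (hl_skew ht hc (hG i)) (ce2_central hext) scaler0 oppr0.
by rewrite -(hcomp_sum (ext_grading G d) u) (linear_funD (lf _)) !c0 addr0.
Qed.

(** Both arguments are split into a multiple of c and a vector of g; bilinearity and centrality on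
    both sides leave only the bracket on g. *)
Lemma ext_bracketE u v : brc u v = (br u.1 v.1, omega u.1 v.1).
Proof.
have [lf rf] := hl_bilinear (ce2_total hext).
case: u v => [x a] [y b] /=; rewrite [(x, a)]pair_central [(y, b)]pair_central.
rewrite (linear_funD (lf _)) (linear_funZ _ _ (lf _)) (ce2_central hext).
rewrite (linear_funD (rf _)) (linear_funZ _ _ (rf _)) central_bracketl.
by rewrite !scaler0 !add0r (ce2_bracket hext).
Qed.

End CentralElement.

Unset Implicit Arguments.
Set Strict Implicit.

Theorem theorem4p4 (K : fieldType) (g : lmodType K) (G : grading g)
  (br : g -> g -> g) (alpha : g -> g)
  (hg : hom_lie_superalgebra G br alpha)
  (hmult : multiplicative2 br alpha)
  (V : vectType K) (GV : grading V) (beta : 'End(V)) (rho : g -> 'End(V))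
  (hrho : representation G br alpha GV beta rho)
  (hstr_alpha : forall x, str GV (rho (alpha x)) = str GV (rho x))
  (hstr_br : forall x y, str GV (rho (br x y)) = 0)
  (d : bool)
  (brc : g * K^o -> g * K^o -> g * K^o) (alphac : g * K^o -> g * K^o)
  (omega : g -> g -> K^o) (lambda : g * K^o -> K^o)
  (hext : central_extension2 G br alpha d brc alphac omega lambda)
  (strrho_c : g * K^o -> K)
  (hstr_lin : scalar strrho_c)
  (hstr_g : forall x, strrho_c (x, 0) = str GV (rho x))
  (hstr_c : strrho_c (central_elt g) = 0) :
  let strrho := fun x => str GV (rho x) in
  let br_rho := ternary G strrho br in
  let br_c_rho := ternary (ext_grading G d) strrho_c brc in
  let omega_rho := ternary G strrho omega in
  [/\ multiplicative3 br_rho alpha,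
      central_extension3 G br_rho alpha d br_c_rho alphac omega_rho lambda
    & forall i j k x1 x2 x3,
        homog G i x1 -> homog G j x2 -> homog G k x3 ->
        br_c_rho (x1, 0) (x2, 0) (x3, 0) =
          (br_rho x1 x2 x3,
           strrho x1 * omega x2 x3
           - (-1) ^+ (i && j) * (strrho x2 * omega x1 x3)
           + (-1) ^+ (k && (i (+) j)) * (strrho x3 * omega x1 x2))].
Proof.
move=> strrho br_rho br_c_rho omega_rho.
have tauE u : strrho_c u = strrho u.1.
  case: u => x a /=; rewrite pair_central hstr_lin hstr_c mulr0 add0r.
  exact: hstr_g.
have tau_lin : scalar strrho.
  move=> a x y; have := hstr_lin a (x, 0) (y, 0); rewrite !tauE /=; exact.
(* As [rho] is even, it sends odd vectors to odd endomorphisms, whose supertrace is zero. *)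
have tau_odd x : strrho (G true x) = 0.
  by apply/str_odd/(rep_even hrho); rewrite /homog hcomp_idem.
have tauc_odd u : strrho_c (ext_grading G d true u) = 0.
  by rewrite tauE tau_odd.
have bf := hl_bilinear hg; have bo := ce2_omega_bilinear hext.
have bc := hl_bilinear (ce2_total hext).
have pairE x y z :
    br_c_rho (x, 0) (y, 0) (z, 0) = (br_rho x y z, omega_rho x y z).
  rewrite /br_c_rho /br_rho /omega_rho !ternary_pureE // /ternary_pure !tauE.
  by rewrite !(ext_bracketE hext).
split.
- exact: (ternary_multiplicative tau_lin tau_odd hg hstr_alpha hmult).
- split.
  + exact: ternary_hom_lie3.
  (* The extended functional sees only the component in g, where the map and the bracket of the
     extension are [alpha] and [br]; its invariance and vanishing on brackets are thus inherited. *)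
  + apply: (ternary_hom_lie3 hstr_lin tauc_odd (ce2_total hext)).
    * by move=> u; rewrite !tauE (ce2_alpha hext); exact: hstr_alpha.
    * by move=> u v; rewrite tauE (ext_bracketE hext); exact: hstr_br.
  + exact: (ternary_trilinear tau_lin tau_odd bo).
  + exact: (ternary_skew tau_lin tau_odd bo (ce2_omega_skew hext)).
  + exact: ce2_lambda_linear hext.
  + exact: pairE.
  (* Each term of the ternary bracket contains c either under the functional or inside a binary
     bracket. *)
  + move=> u v; have cl := central_bracketl hext; have cr := ce2_central hext.
    rewrite /br_c_rho !ternary_pureE // /ternary_pure hstr_c.
    by rewrite !cl !cr !scale0r !scaler0 !subr0 !addr0.
  + exact: ce2_alpha hext.
- move=> i j k x1 x2 x3 h1 h2 h3; rewrite pairE; congr (_, _).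
  (* Scaling in [K^o] is multiplication in [K], so the signed formula matches by conversion. *)
  exact: (ternaryE tau_lin bo h1 h2 h3).
Qed.
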